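(* Suppose that for each $m\in\mathfrak M$, $U_m$ is Lipschitz continuous over $[a_m,b_m]$ with random Lipschitz modulus $L_m$ almost surely, where $\mathbb{E}[L_m]<\infty$ and the expectation is taken with respect to the probability distribution of the random factors underlying $U(x)$. Then the following assertions hold. (i) $$|\vartheta-\vartheta_I|\le\mathbb{E}[L]\,\Delta,$$ where $L:=\sum_{m\in\mathfrak M}L_m$. (ii) Let $\{x_I\}$ be a sequence of optimal solutions obtained from solving $\max_{x\in\mathfrak X}\mathbb{E}[u(x;V)]$. Then every cluster point of the sequence is an optimal solution of $\max_{x\in\mathfrak X}\mathbb{E}[U(x)]$, that is, $$\lim_{I\to\infty}\mathbb{D}(X_I,X^* )=0.$$
   Context: $\mathfrak M=\{1,\dots,M\}$ indexes the attributes. For each $m\in\mathfrak M$, $U_m$ is a continuous nondecreasing random utility function on $[a_m,b_m]$ with $U_m(a_m)=0$, and $U(x)=\sum_{m\in\mathfrak M}U_m(x_m)$ is normalized so that $U(a_1,\dots,a_M)=0$ and $U(b_1,\dots,b_M)=1$ almost surely. $\mathfrak X\subseteq[a_1,b_1]\times\cdots\times[a_M,b_M]$ is compact. The true problem is $$\vartheta:=\max_{x\in\mathfrak X}\mathbb{E}[U(x)],$$ with set of optimal solutions $X^*$. For each $m$ let $a_m=t_{m,0}<t_{m,1}<\cdots<t_{m,I_m}=b_m$ be breakpoints, $\mathfrak I_m=\{1,\dots,I_m\}$, $I=\sum_mI_m$, and $\Delta:=\max_{m\in\mathfrak M}\max_{i\in\mathfrak I_m}(t_{m,i}-t_{m,i-1})$.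 Let $V_{m,i}:=U_m(t_{m,i})-U_m(t_{m,i-1})$, $V_m=(V_{m,1},\dots,V_{m,I_m})^T$, $V=(V_1^T,\dots,V_M^T)^T$. Let $u_m(\cdot;V_m)$ be the piecewise linear function on $[a_m,b_m]$ with these breakpoints that satisfies $u_m(t_{m,i};V_m)=U_m(t_{m,i})$ for all $i$ and $u_m(a_m;V_m)=0$, and $u(x;V)=\sum_{m\in\mathfrak M}u_m(x_m;V_m)$. The approximate problem is $$\vartheta_I:=\max_{x\in\mathfrak X}\mathbb{E}[u(x;V)],$$ with set of optimal solutions $X_I$. It is assumed throughout that the breakpoints are chosen so that $I\to\infty$ ensures $\Delta\to0$. For sets $A,B$, $\mathbb D(A,B):=\sup_{a\in A}\inf_{b\in B}\|a-b\|$ is the excess of $A$ over $B$. *)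

(* Defs.v *)
From HB Require Import structures.
From mathcomp Require Import all_boot all_order all_algebra.
From mathcomp Require Import all_classical all_reals all_analysis.
Set Implicit Arguments.
Unset Strict Implicit.
Unset Printing Implicit Defensive.
Import Order.TTheory GRing.Theory Num.Theory.
Import numFieldNormedType.Exports.
Local Open Scope classical_set_scope.
Local Open Scope ring_scope.

(* Only the values [bpt m i] with [i <= bnum m] are meaningful. *)
Record breakpoints (R : realType) (M : nat) (a b : 'rV[R]_M) := Breakpoints {
  bnum : 'I_M -> nat ;
  bpt : 'I_M -> nat -> R ;
  bnum_gt0 : forall m, (0 < bnum m)%N ;
  bpt_first : forall m, bpt m 0%N = a ord0 m ;
  bpt_last : forall m, bpt m (bnum m) = b ord0 m ;
  bpt_lt : forall m i, (i < bnum m)%N -> bpt m i < bpt m i.+1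
}.

Definition bp_total (R : realType) (M : nat) (a b : 'rV[R]_M)
    (p : breakpoints a b) : nat :=
  (\sum_(m < M) bnum p m)%N.

Definition bp_mesh (R : realType) (M : nat) (a b : 'rV[R]_M)
    (p : breakpoints a b) : R :=
  \big[Num.max/0]_(m < M) \big[Num.max/0]_(i < bnum p m)
    (bpt p m i.+1 - bpt p m i).

(* [U m w] is the realization at [w] of the m-th single-attribute utility; only
   its values on [`[a m, b m]] matter. *)
Definition utility (R : realType) (T : Type) (M : nat)
    (U : 'I_M -> T -> R -> R) (w : T) (x : 'rV[R]_M) : R :=
  \sum_(m < M) U m w (x ord0 m).

(* Increments are indexed from 0: [increment p U w m i] is the increment over
   the cell from [bpt p m i] to [bpt p m i.+1]. *)
Definition increment (R : realType) (T : Type) (M : nat) (a b : 'rV[R]_M)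
    (p : breakpoints a b) (U : 'I_M -> T -> R -> R) (w : T)
    (m : 'I_M) (i : nat) : R :=
  U m w (bpt p m i.+1) - U m w (bpt p m i).

(* The continuous function that vanishes at [t 0] and is affine with increment
   [v i] on each cell [[t i, t i.+1]], [i < n]; the i-th factor is the fraction
   of cell i lying to the left of [s].  See [pwlin_cell] and [pwlin_bpt]. *)
Definition pwlin (R : realType) (n : nat) (t v : nat -> R) (s : R) : R :=
  \sum_(i < n) v i * Num.max 0 (Num.min 1 ((s - t i) / (t i.+1 - t i))).

Definition pwlin_utility (R : realType) (M : nat) (a b : 'rV[R]_M)
    (p : breakpoints a b) (v : 'I_M -> nat -> R) (x : 'rV[R]_M) : R :=
  \sum_(m < M) pwlin (bnum p m) (bpt p m) (v m) (x ord0 m).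

Section PwlinSpec.
Variables (R : realType) (n : nat) (t v : nat -> R).
Hypothesis t_lt : forall i, (i < n)%N -> t i < t i.+1.

Let t_le i j : (i <= j <= n)%N -> t i <= t j.
Proof.
case/andP; elim: j => [|j IH]; first by rewrite leqn0 => /eqP ->.
rewrite leq_eqVlt => /orP[/eqP ->//|ij] jn.
by apply: (le_trans (IH ij (ltnW jn))); apply/ltW/t_lt.
Qed.

Lemma pwlin_cell k s : (k < n)%N -> t k <= s <= t k.+1 ->
  pwlin n t v s =
    \sum_(i < k) v i + v k * ((s - t k) / (t k.+1 - t k)).
Proof.
move=> kn /andP[ks sk]; rewrite /pwlin.
rewrite -(big_mkord xpredT
  (fun i => v i * Num.max 0 (Num.min 1 ((s - t i) / (t i.+1 - t i))))).
rewrite (big_cat_nat (n := k)) ?(ltnW kn)//=; congr (_ + _).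
  rewrite big_mkord; apply: eq_bigr => i _.
  have ti : t i < t i.+1 by apply: t_lt; apply: ltn_trans (ltn_ord i) kn.
  have tis : t i.+1 <= s by apply: le_trans ks; apply: t_le; rewrite ltn_ord ltnW.
  rewrite min_l ?max_r ?mulr1// ler_pdivlMr ?subr_gt0// mul1r.
  by rewrite lerB.
rewrite big_ltn// big_nat big1 ?addr0.
  have tk := t_lt kn.
  have le1 : (s - t k) / (t k.+1 - t k) <= 1.
    by rewrite ler_pdivrMr ?subr_gt0// mul1r lerB.
  by rewrite min_r// max_r// divr_ge0 ?subr_ge0// ltW.
move=> i /andP[ki i_n]; have ti := t_lt i_n.
have sti : s <= t i by apply: le_trans sk _; apply: t_le; rewrite ki ltnW.
rewrite max_l ?mulr0// ge_min; apply/orP; right.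
by rewrite ler_pdivrMr ?subr_gt0// mul0r subr_le0.
Qed.

Lemma pwlin_bpt k : (0 < n)%N -> (k <= n)%N ->
  pwlin n t v (t k) = \sum_(i < k) v i.
Proof.
move=> n0; case: k => [_|k kn].
  by rewrite (@pwlin_cell 0)// ?lexx ?ltW ?t_lt// subrr mul0r mulr0 addr0.
rewrite (@pwlin_cell k)//; last by rewrite lexx ltW ?t_lt.
by rewrite divff ?mulr1 ?big_ord_recr// subr_eq0 gt_eqF// t_lt.
Qed.

End PwlinSpec.

Lemma pwlin_interpolates (R : realType) (T : Type) (M : nat) (a b : 'rV[R]_M)
    (p : breakpoints a b) (U : 'I_M -> T -> R -> R) (w : T) (m : 'I_M) k :
  U m w (a ord0 m) = 0 -> (k <= bnum p m)%N ->
  pwlin (bnum p m) (bpt p m) (increment p U w m) (bpt p m k)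
    = U m w (bpt p m k).
Proof.
move=> U0 kn; rewrite pwlin_bpt ?bnum_gt0//; last exact: bpt_lt.
rewrite -(big_mkord xpredT (increment p U w m)) telescope_sumr//.
by rewrite bpt_first U0 subr0.
Qed.

Definition is_max (R : realType) (A : set (\bar R)) (v : \bar R) : Prop :=
  A v /\ ubound A v.

Definition argmax (R : realType) (E : Type) (X : set E) (f : E -> \bar R) :
    set E :=
  [set x | X x /\ forall y, X y -> (f y <= f x)%E].

Definition norm2 (R : realType) (M : nat) (x : 'rV[R]_M) : R :=
  Num.sqrt (\sum_(m < M) x ord0 m ^+ 2).

(* Extended-real valued, so it is -oo when [A] is empty and +oo when [B] is
   empty while [A] is not. *)
Definition excess (R : realType) (M : nat) (A B : set 'rV[R]_M) : \bar R :=
  ereal_sup [set ereal_inf [set (norm2 (x - y))%:E | y in B] | x in A].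

(* Main.v *)
Require Import Defs.
From HB Require Import structures.
From mathcomp Require Import all_boot all_order all_algebra.
From mathcomp Require Import all_classical all_reals all_analysis.
From mathcomp Require Import measurable_realfun ring lra.
Set Implicit Arguments.
Unset Strict Implicit.
Unset Printing Implicit Defensive.
Import Order.TTheory GRing.Theory Num.Theory.
Import numFieldNormedType.Exports.
Local Open Scope classical_set_scope.
Local Open Scope ring_scope.

(** The randomness can be averaged out before anything else is done.  Put
    phi_m(s) = E[U_m(s)].  As U_m is almost surely L_m-Lipschitz and vanishes at
    a_m, the function phi_m is E[L_m]-Lipschitz on [a_m, b_m] and vanishes at
    a_m ([mean_utility_lipschitz], [mean_utility_a]).  The expected true utility
    of x is sum_m phi_m(x_m) ([expectation_utility]).  The approximate utility
    is, for fixed x, a finite linear combination of increments of the U_m, so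
    its expectation is the piecewise linear interpolation of the phi_m at x
    ([expectation_pwlin_utility]).  Both problems are thus deterministic.

    On a cell, the interpolant of an l-Lipschitz function is a convex
    combination of the two endpoint values, each within l times the mesh of the
    function ([pwlin_dist]).  Summing over the attributes, the two objectives
    differ on the feasible set by at most c = E[L] Delta ([utility_pwlin_dist]).

    The rest is the stability of maximization of a continuous F over a compact
    set under uniform perturbations of size c.  Maximal values move by at most
    c ([max_value_dist]), which is the error bound.  A maximizer of the perturbed
    objective is 2c-optimal for F ([argmax_near_optimal]).  As c tends to 0, continuity of
    F at a cluster point makes it optimal ([cluster_argmax]).  For the excess,
    the feasible points at distance at least e from every maximizer form a
    compact set on which F stays a positive amount below its maximum
    ([argmax_gap]), so a 2c-optimal point is closer than e to some maximizer
    once 2c is below that amount ([excess_argmax_cvg0]). *)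

(** * Piecewise linear interpolation of Lipschitz functions *)

Section LipschitzInterpolation.
Variables (R : realType) (n : nat) (t : nat -> R).
Hypothesis n_gt0 : (0 < n)%N.
Hypothesis t_lt : forall i, (i < n)%N -> t i < t i.+1.

Lemma cell_exists s : t 0%N <= s <= t n ->
  exists2 k, (k < n)%N & t k <= s <= t k.+1.
Proof.
case/andP=> t0s; elim: n n_gt0 => // k IH _ sk.
have [stk|tks] := leP s (t k); last by exists k; rewrite ?ltnSn// ltW.
case: k IH sk stk => [|k] IH sk stk; first by exists 0%N; rewrite ?t0s.
have [j jk sj] := IH isT stk.
by exists j => //; rewrite ltnW.
Qed.

Lemma breakpoint_bounds k : (k <= n)%N -> t 0%N <= t k <= t n.
Proof.
have mono j : (j <= n)%N -> forall i, (i <= j)%N -> t i <= t j.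
  elim: j => [_ i|j IH jn i]; first by rewrite leqn0 => /eqP ->.
  rewrite leq_eqVlt => /orP[/eqP ->//|ij].
  exact: le_trans (IH (ltnW jn) _ ij) (ltW (t_lt jn)).
by move=> kn; rewrite !mono.
Qed.

(** For s in a cell and q the fraction of the cell to the left of s, the error
    is (1 - q) (f s - f (t k)) + q (f s - f (t k.+1)), a convex combination of two
    differences of f over distances at most h. *)
Lemma pwlin_dist (f : R -> R) (l h : R) :
  f (t 0%N) = 0 ->
  (forall r s, r \in `[t 0%N, t n] -> s \in `[t 0%N, t n] ->
     `|f r - f s| <= l * `|r - s|) ->
  (forall i, (i < n)%N -> t i.+1 - t i <= h) ->
  forall s, s \in `[t 0%N, t n] ->
  `|f s - pwlin n t (fun i => f (t i.+1) - f (t i)) s| <= l * h.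
Proof.
move=> f0 lipf mesh s sI.
have inI k : (k <= n)%N -> t k \in `[t 0%N, t n].
  by move=> kn; rewrite in_itv/= breakpoint_bounds.
have [k kn sk] : exists2 k, (k < n)%N & t k <= s <= t k.+1.
  by apply: cell_exists; move: sI; rewrite in_itv.
rewrite (pwlin_cell _ t_lt kn sk).
rewrite -(big_mkord xpredT (fun i => f (t i.+1) - f (t i))) telescope_sumr//.
rewrite f0 subr0.
have tk := t_lt kn.
case/andP: sk => tks stk.
set q := _ / _; have q01 : 0 <= q <= 1.
  by rewrite divr_ge0 ?subr_ge0 ?(ltW tk)//= ler_pdivrMr ?subr_gt0// mul1r lerB.
clearbody q.
(* The cell of s is nondegenerate, which forces the constant to be >= 0. *)
have l0 : 0 <= l.
  have := le_trans (normr_ge0 _) (lipf _ _ (inI _ kn) (inI _ (ltnW kn))).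
  by rewrite pmulr_lge0// normr_gt0 subr_eq0 gt_eqF.
have far r : t k <= r <= t k.+1 -> r \in `[t 0%N, t n] -> `|f s - f r| <= l * h.
  move=> /andP[r1 r2] rI; apply: le_trans (lipf _ _ sI rI) _.
  rewrite ler_wpM2l// (le_trans _ (mesh _ kn))// ler_norml; lra.
have A := far _ _ (inI _ (ltnW kn)); have B := far _ _ (inI _ kn).
have {}A : `|f s - f (t k)| <= l * h by apply: A; rewrite lexx ltW.
have {}B : `|f s - f (t k.+1)| <= l * h by apply: B; rewrite lexx ltW.
have -> : f s - (f (t k) + (f (t k.+1) - f (t k)) * q) =
  (1 - q) * (f s - f (t k)) + q * (f s - f (t k.+1)) by ring.
apply: le_trans (ler_normD _ _) _; rewrite !normrM.
case/andP: q01 => q0 q1; rewrite (ger0_norm q0) ger0_norm ?subr_ge0//.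
have -> : l * h = (1 - q) * (l * h) + q * (l * h) by ring.
by rewrite lerD// ler_wpM2l// subr_ge0.
Qed.

End LipschitzInterpolation.

(** * Continuity of the interpolant and of the Euclidean norm *)

Lemma pwlin_continuous (R : realType) n (t v : nat -> R) :
  continuous (pwlin n t v).
Proof.
apply: continuous_big => [|i _ s]; first exact: add_continuous.
apply: cvgM; first exact: cvg_cst.
apply: (@continuous_max R R (cst 0)
  (cst 1 \min (fun z : R => (z - t i) / (t i.+1 - t i)))).
  exact: cvg_cst.
apply: continuous_min; first exact: cvg_cst.
by apply: cvgM; [apply: cvgB; [exact: cvg_id|exact: cvg_cst]|exact: cvg_cst].
Qed.

Lemma norm2_continuous (R : realType) M (y : 'rV[R]_M) :
  continuous (fun x : 'rV[R]_M => norm2 (x - y)).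
Proof.
move=> x; apply: (@continuous_comp _ _ _
  (fun x : 'rV[R]_M => \sum_(m < M) (x - y) ord0 m ^+ 2) Num.sqrt); last first.
  exact: sqrt_continuous.
apply: continuous_big => [|m _ z]; first exact: add_continuous.
under eq_fun do rewrite !mxE.
apply: (@continuous_comp _ _ _ (fun u : 'rV[R]_M => u ord0 m)
  (fun s : R => (s - y ord0 m) ^+ 2)); first exact: coord_continuous.
by apply: cvgM; apply: cvgB; solve [exact: cvg_id|exact: cvg_cst].
Qed.

(** * Stability of maximizers under uniform perturbation *)

Section Stability.
Variables (R : realType) (E : topologicalType) (X : set E).
Implicit Types F G : E -> R.

Lemma argmax_fin F (x : E) :
  argmax X (fun z => (F z)%:E) x <-> X x /\ forall z, X z -> F z <= F x.
Proof. by split=> -[Xx h]; split=> // z /h; rewrite lee_fin. Qed.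

Lemma argmax_neq0 F : X !=set0 -> compact X -> {within X, continuous F} ->
  argmax X (fun z => (F z)%:E) !=set0.
Proof.
move=> X0 Xc cF; have [c cX cmax] := compact_EVT_max X0 Xc cF.
exists c; apply/argmax_fin; split; first exact: set_mem.
by move=> z Xz; apply/cmax/mem_set.
Qed.

(** Each maximal value is at least the value of the same objective at the other
    maximizer, where the two objectives differ by at most c. *)
Lemma max_value_dist F G (c : R) x y :
  (forall z, X z -> `|F z - G z| <= c) ->
  argmax X (fun z => (F z)%:E) x -> argmax X (fun z => (G z)%:E) y ->
  `|F x - G y| <= c.
Proof.
move=> FG /argmax_fin[Xx Fx] /argmax_fin[Xy Gy].
have := FG _ Xx; have := FG _ Xy; have := Fx _ Xy; have := Gy _ Xx.
rewrite !ler_norml => ? ? /andP[? ?] /andP[? ?]; apply/andP; split; lra.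
Qed.

(** Replacing F by G costs c at z and again c at y. *)
Lemma argmax_near_optimal F G (c : R) y :
  (forall z, X z -> `|F z - G z| <= c) ->
  argmax X (fun z => (G z)%:E) y -> forall z, X z -> F z <= F y + c *+ 2.
Proof.
move=> FG /argmax_fin[Xy Gy] z Xz.
have := FG _ Xz; have := FG _ Xy; have := Gy _ Xz.
rewrite !ler_norml mulr2n => ? /andP[? ?] /andP[? ?]; lra.
Qed.

(** F attains its maximum over the compact set X `&` D, and that value is below
    the maximum over X because no maximizer lies in D; delta is the difference
    (any positive number when X `&` D is empty). *)
Lemma argmax_gap F (D : set E) : X !=set0 -> compact X ->
  {within X, continuous F} -> closed D ->
  D `&` argmax X (fun z => (F z)%:E) = set0 ->
  exists2 delta, 0 < delta &
    forall x, X x -> D x -> exists2 z, X z & F x + delta <= F z.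
Proof.
move=> X0 Xc cF clD DX.
have [XD0|/set0P XD] := eqVneq (X `&` D) set0.
  exists 1 => // x Xx Dx; suff : set0 x by [].
  by rewrite -XD0.
have cFD : {within X `&` D, continuous F}.
  by apply: continuous_subspaceW cF => x [].
have [y yXD ymax] := compact_EVT_max XD (compact_closedI Xc clD) cFD.
have [Xy Dy] := set_mem yXD.
have [z /argmax_fin [Xz zmax]] := argmax_neq0 X0 Xc cF.
exists (F z - F y).
  rewrite subr_gt0 ltNge; apply/negP => zy.
  suff : set0 y by [].
  rewrite -DX; split=> //; apply/argmax_fin; split=> // u /zmax.
  by move=> /le_trans; apply.
move=> x Xx Dx; exists z => //; have := ymax x (mem_set (conj Xx Dx)); lra.
Qed.

(** If F p fell short of some F z, continuity would keep F clearly below F z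
    near p, while infinitely many x k come near p and are 2 c k-optimal. *)
Lemma cluster_argmax F (G : nat -> E -> R) (c : nat -> R) (x : nat -> E) :
  closed X -> {within X, continuous F} ->
  (forall k z, X z -> `|F z - G k z| <= c k) -> c @ \oo --> (0 : R) ->
  (forall k, argmax X (fun z => (G k z)%:E) (x k)) ->
  cluster (x @ \oo) `<=` argmax X (fun z => (F z)%:E).
Proof.
move=> Xcl cF FG c0 xopt p clp.
have Xx k : X (x k) by case: (xopt k).
have Xp : X p.
  by apply: Xcl => B Bp; apply: clp Bp; exists 0%N => // k _; exact: Xx.
apply/argmax_fin; split=> // z Xz; rewrite leNgt; apply/negP => pz.
(* Three units of r are lost: one by moving from p to x k, two by the near
   optimality of x k; the shortfall of p must exceed this. *)
pose r := (F z - F p) / 4.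
have r0 : 0 < r by rewrite divr_gt0// subr_gt0.
have /subspace_continuousP/(_ p Xp) cFp := cF.
have near_p : \forall y \near within X (nbhs p), `|F p - F y| < r.
  by move/cvgr_dist_lt : cFp; exact.
have near_oo : \forall k \near \oo, `|c k| < r by move/cvgr0Pnorm_lt : c0; exact.
have visits : (x @ \oo) [set y | exists2 k, `|c k| < r & y = x k].
  by apply: filterS near_oo => k ck; exists k.
have [_ [[k ck ->] /(_ (Xx k))]] := clp _ _ visits near_p.
have := argmax_near_optimal (FG k) (xopt k) Xz.
move: ck; rewrite !ltr_norml /r mulr2n => /andP[? ?] ? /andP[? ?]; lra.
Qed.

End Stability.

(** The gap lemma is applied to the closed set D of the points at distance at
    least e from every maximizer of F; maximizers of G k leave D once
    2 c k < delta.  The sets of maximizers of G k have to be nonempty since the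
    excess of the empty set is -oo. *)
Lemma excess_argmax_cvg0 (R : realType) M (X : set 'rV[R]_M)
    (F : 'rV[R]_M -> R) (G : nat -> 'rV[R]_M -> R) (c : nat -> R) :
  X !=set0 -> compact X -> {within X, continuous F} ->
  (forall k, argmax X (fun z => (G k z)%:E) !=set0) ->
  (forall k z, X z -> `|F z - G k z| <= c k) -> c @ \oo --> (0 : R) ->
  (fun k => excess (argmax X (fun z => (G k z)%:E))
                   (argmax X (fun z => (F z)%:E))) @ \oo --> 0%E.
Proof.
move=> X0 Xc cF G0 FG c0.
set S := argmax X (fun z => (F z)%:E).
have ge0 k : (0 <= excess (argmax X (fun z => (G k z)%:E)) S)%E.
  have [x xG] := G0 k.
  apply: le_trans (ereal_sup_ubound _); last by exists x.
  by apply: le_ereal_inf_tmp => _ [y _ <-]; rewrite lee_fin sqrtr_ge0.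
have small e : 0 < e ->
    \forall k \near \oo, (excess (argmax X (fun z => (G k z)%:E)) S <= e%:E)%E.
  move=> e0; pose D := [set x | forall y, S y -> e <= norm2 (x - y)].
  have clD : closed D.
    have -> : D = \bigcap_(y in S) (fun x => norm2 (x - y)) @^-1` [set s | e <= s].
      by apply/seteqP; split=> x h y /h.
    apply: closed_bigI => y _; apply: preimage_closed; last exact: closed_ge.
    by move=> x _; exact: norm2_continuous.
  have DS : D `&` S = set0.
    apply/seteqP; split=> // y [/[apply]].
    rewrite subrr /norm2 big1 ?sqrtr0 ?leNgt ?e0// => i _.
    by rewrite mxE expr0n.
  have [delta d0 gap] := argmax_gap X0 Xc cF clD DS.
  have : \forall k \near \oo, `|c k| < delta / 2.
    by move/cvgr0Pnorm_lt : c0; apply; rewrite divr_gt0.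
  apply: filterS => k ck; apply: ge_ereal_sup => _ [x xopt <-].
  have [Dx|] := pselect (D x).
    have [z Xz] := gap x xopt.1 Dx.
    have := argmax_near_optimal (FG k) xopt Xz.
    move: ck; rewrite ltr_norml (mulr2n (c k)) => /andP[? ?] ? ?; exfalso; lra.
  move=> /existsNP[y /not_implyP[Sy /negP]]; rewrite -ltNge => xy.
  apply: le_trans (ereal_inf_lbound _) _; first by exists y.
  by rewrite lee_fin ltW.
apply/fine_cvgP; split.
  apply: filterS (small 1 ltr01) => k k1.
  by rewrite ge0_fin_numE//; apply: le_lt_trans k1 _; rewrite ltry.
apply/cvgr0Pnorm_le => e e0.
apply: filterS (small e e0) => k ke.
rewrite /= ger0_norm ?fine_ge0// -lee_fin fineK//.
by rewrite ge0_fin_numE//; apply: le_lt_trans ke _; rewrite ltry.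
Qed.

(** * Integrals of functions that are compared almost everywhere *)

Section ExpectationLemmas.
Context {d : measure_display} {T : measurableType d} {R : realType}.
Variable mu : {measure set T -> \bar R}.
Implicit Types f g : T -> R.

Lemma ae_dominated_integrable f g : measurable_fun setT f ->
  mu.-integrable setT (EFin \o g) ->
  {ae mu, forall w, `|f w| <= g w} -> mu.-integrable setT (EFin \o f).
Proof.
move=> mf /integrableP[mg gfin] fg; apply/integrableP; split.
  exact/measurable_EFinP.
apply: le_lt_trans gfin; apply: ae_ge0_le_integral => //.
- by apply: measurableT_comp => //; exact/measurable_EFinP.
- by apply: measurableT_comp.
- apply: filterS fg => w fgw _ /=.
  by rewrite lee_fin (le_trans fgw)// ler_norm.
Qed.

(** The difference g - f equals its absolute value almost everywhere. *)
Lemma ae_le_Rintegral f g :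
  mu.-integrable setT (EFin \o f) -> mu.-integrable setT (EFin \o g) ->
  {ae mu, forall w, f w <= g w} ->
  \int[mu]_w f w <= \int[mu]_w g w.
Proof.
move=> intf intg fg.
rewrite -subr_ge0 -RintegralB// /Rintegral fine_ge0//.
have mgf : measurable_fun setT (fun w => (g w - f w)%:E).
  apply/measurable_EFinP; apply: measurable_funB; apply/measurable_EFinP;
  by [case/integrableP : intg|case/integrableP : intf].
rewrite (ae_eq_integral (fun w => `|(g w - f w)%:E|%E))//.
- by apply: integral_ge0.
- exact: measurableT_comp.
- by apply: filterS fg => w fgw _ /=; rewrite ger0_norm// subr_ge0.
Qed.

Lemma ae_Rintegral_dist f g h :
  mu.-integrable setT (EFin \o f) -> mu.-integrable setT (EFin \o g) ->
  mu.-integrable setT (EFin \o h) ->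
  {ae mu, forall w, `|f w - g w| <= h w} ->
  `|\int[mu]_w f w - \int[mu]_w g w| <= \int[mu]_w h w.
Proof.
move=> intf intg inth fgh.
have intfg : mu.-integrable setT (EFin \o (fun w => f w - g w)).
  exact: (integrableB measurableT intf intg).
rewrite -RintegralB//; apply: le_trans (le_normr_Rintegral _ _) _ => //.
apply: ae_le_Rintegral => //.
exact: (integrable_abse intfg).
Qed.

Lemma Rintegral_sum (I : Type) (s : seq I) (f : I -> T -> R) :
  (forall i, mu.-integrable setT (EFin \o f i)) ->
  \int[mu]_w (\sum_(i <- s) f i w) = \sum_(i <- s) \int[mu]_w f i w.
Proof.
move=> intf; rewrite /Rintegral.
under eq_integral do rewrite -sumEFin.
rewrite integral_sum//.
by apply/esym/sum_fine => i _; apply: integrable_fin_num => //; exact: intf.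
Qed.

Lemma integrable_sum_EFin (I : Type) (s : seq I) (f : I -> T -> R) :
  (forall i, mu.-integrable setT (EFin \o f i)) ->
  mu.-integrable setT (EFin \o (fun w => \sum_(i <- s) f i w)).
Proof.
move=> intf; apply: (eq_integrable _ (fun w => \sum_(i <- s) (f i w)%:E)%E) => //.
  by move=> w _; rewrite /= sumEFin.
by apply: integrable_sum => // i _; exact: intf.
Qed.

Lemma integrableZr_EFin (c : R) f : mu.-integrable setT (EFin \o f) ->
  mu.-integrable setT (EFin \o (fun w => f w * c)).
Proof. exact: (integrableZr measurableT c). Qed.

End ExpectationLemmas.

Lemma expectation_Rintegral d (T : measurableType d) (R : realType)
    (P : probability T R) (f : T -> R) :
  P.-integrable setT (EFin \o f) -> 'E_P[f]%E = (\int[P]_w f w)%:E.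
Proof.
by move=> intf; rewrite unlock /Rintegral fineK// integrable_fin_num.
Qed.

(** * The expected single-attribute utilities *)

Section MeanUtility.
Context {d : measure_display} {T : measurableType d} {R : realType}.
Variables (P : probability T R) (M : nat) (a b : 'rV[R]_M).
Variables (U : 'I_M -> T -> R -> R) (L : 'I_M -> {RV P >-> R}).

(** The dummy argument makes the family of expected utilities itself a utility
    over a one-point sample space, so that [utility] and [increment] apply to
    it. *)
Definition mean_utility (m : 'I_M) (_ : unit) (s : R) : R := \int[P]_w U m w s.

Hypothesis ab : forall m, a ord0 m < b ord0 m.
Hypothesis U_meas : forall m s, s \in `[a ord0 m, b ord0 m] ->
  measurable_fun [set: T] (fun w => U m w s).
Hypothesis U_a : forall m, {ae P, forall w, U m w (a ord0 m) = 0}.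
Hypothesis L_fin : forall m, ('E_P[L m] < +oo)%E.
Hypothesis U_lip : forall m, {ae P, forall w,
  (L m w).-lipschitz_(`[a ord0 m, b ord0 m]%classic) (U m w)}.

Lemma a_in m : a ord0 m \in `[a ord0 m, b ord0 m].
Proof. by rewrite in_itv/= lexx ltW. Qed.

Lemma b_in m : b ord0 m \in `[a ord0 m, b ord0 m].
Proof. by rewrite in_itv/= lexx ltW. Qed.

Lemma lipschitz_bound m : {ae P, forall w, forall r s,
  r \in `[a ord0 m, b ord0 m] -> s \in `[a ord0 m, b ord0 m] ->
  `|U m w r - U m w s| <= L m w * `|r - s|}.
Proof.
by apply: filterS (U_lip m) => w lip r s rI sI; exact: (lip (r, s)).
Qed.

(** The Lipschitz bound between the two distinct endpoints forces the sign. *)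
Lemma lipschitz_modulus_ge0 m : {ae P, forall w, 0 <= L m w}.
Proof.
apply: filterS (lipschitz_bound m) => w lip.
have := le_trans (normr_ge0 _) (lip _ _ (b_in m) (a_in m)).
by rewrite pmulr_lge0// normr_gt0 subr_eq0 gt_eqF.
Qed.

Lemma lipschitz_modulus_integrable m : P.-integrable setT (EFin \o L m).
Proof.
apply/integrableP; split; first exact/measurable_EFinP.
have := L_fin m; rewrite unlock; apply: le_lt_trans.
rewrite le_eqVlt; apply/orP; left; apply/eqP; apply: ae_eq_integral => //.
- by apply: measurableT_comp => //; exact/measurable_EFinP.
- exact/measurable_EFinP.
- by apply: filterS (lipschitz_modulus_ge0 m) => w L0 _ /=; rewrite ger0_norm.
Qed.

(** Anchored at U m w (a m) = 0, the Lipschitz bound dominates U m w s by a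
    multiple of the integrable modulus. *)
Lemma utility_integrable m s : s \in `[a ord0 m, b ord0 m] ->
  P.-integrable setT (EFin \o (fun w => U m w s)).
Proof.
move=> sI; apply: (@ae_dominated_integrable _ _ _ _ _
    (fun w => L m w * `|s - a ord0 m|)).
- exact: U_meas.
- exact/integrableZr_EFin/lipschitz_modulus_integrable.
- apply: filterS2 (lipschitz_bound m) (U_a m) => w lip U0.
  by have := lip _ _ sI (a_in m); rewrite U0 subr0.
Qed.

Lemma mean_utility_a m : mean_utility m tt (a ord0 m) = 0.
Proof.
rewrite /mean_utility /Rintegral (ae_eq_integral (cst 0%E))//.
- by rewrite integral0.
- by apply/measurable_EFinP/U_meas/a_in.
- by apply: filterS (U_a m) => w U0 _; rewrite /= U0.
Qed.

Lemma mean_utility_lipschitz m r s :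
  r \in `[a ord0 m, b ord0 m] -> s \in `[a ord0 m, b ord0 m] ->
  `|mean_utility m tt r - mean_utility m tt s|
    <= (\int[P]_w L m w) * `|r - s|.
Proof.
move=> rI sI; rewrite -RintegralZr//; last exact: lipschitz_modulus_integrable.
apply: ae_Rintegral_dist; try exact: utility_integrable.
  exact/integrableZr_EFin/lipschitz_modulus_integrable.
by apply: filterS (lipschitz_bound m) => w; apply.
Qed.

Lemma expectation_utility (x : 'rV[R]_M) :
  (forall m, x ord0 m \in `[a ord0 m, b ord0 m]) ->
  'E_P[fun w => utility U w x]%E = (utility mean_utility tt x)%:E.
Proof.
move=> xI; have intU m := utility_integrable (xI m).
rewrite expectation_Rintegral; last exact: integrable_sum_EFin.
by rewrite Rintegral_sum.
Qed.

(** At a fixed point x the interpolant is linear in the increments, and taking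
    increments commutes with the expectation. *)
Lemma expectation_pwlin_utility (p : breakpoints a b) (x : 'rV[R]_M) :
  'E_P[fun w => pwlin_utility p (increment p U w) x]%E =
  (pwlin_utility p (increment p mean_utility tt) x)%:E.
Proof.
have bptI m k : (k <= bnum p m)%N -> bpt p m k \in `[a ord0 m, b ord0 m].
  move=> kn; rewrite in_itv/= -(bpt_first p m) -(bpt_last p m).
  exact: breakpoint_bounds (@bpt_lt _ _ _ _ p m) _ kn.
have intI m (i : 'I_(bnum p m)) :
    P.-integrable setT (EFin \o (fun w => increment p U w m i)).
  have intU k : (k <= bnum p m)%N -> P.-integrable setT (EFin \o (U m ^~ (bpt p m k))).
    by move=> kn; apply/utility_integrable/bptI.
  exact: (integrableB measurableT (intU _ (ltn_ord i)) (intU _ (ltnW (ltn_ord i)))).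
have intC m (i : 'I_(bnum p m)) (c : R) := integrableZr_EFin c (intI m i).
rewrite expectation_Rintegral; last first.
  by apply: integrable_sum_EFin => m; apply: integrable_sum_EFin => i; exact: intC.
rewrite Rintegral_sum; last first.
  by move=> m; apply: integrable_sum_EFin => i; exact: intC.
congr EFin; apply: eq_bigr => m _; rewrite Rintegral_sum; last first.
  by move=> i; exact: intC.
apply: eq_bigr => i _; rewrite RintegralZr//.
congr (_ * _); rewrite RintegralB//; apply: utility_integrable; apply: bptI => //.
exact: ltnW.
Qed.

Lemma utility_pwlin_dist (p : breakpoints a b) (x : 'rV[R]_M) :
  (forall m, x ord0 m \in `[a ord0 m, b ord0 m]) ->
  `|utility mean_utility tt x
    - pwlin_utility p (increment p mean_utility tt) x|
  <= (\sum_(m < M) \int[P]_w L m w) * bp_mesh p.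
Proof.
move=> xI; rewrite -sumrB mulr_suml.
apply: le_trans (ler_norm_sum _ _ _) _; apply: ler_sum => m _.
have t0 := bpt_first p m; have tn := bpt_last p m.
apply: pwlin_dist.
- exact: bnum_gt0.
- exact: bpt_lt.
- by rewrite t0 mean_utility_a.
- by move=> r s; rewrite t0 tn; exact: mean_utility_lipschitz.
- move=> i ilt; apply: le_trans (le_bigmax _ _ m).
  exact: (le_bigmax _ (fun i : 'I_(bnum p m) => bpt p m i.+1 - bpt p m i)
    (Ordinal ilt)).
- by rewrite t0 tn.
Qed.

Lemma utility_mean_continuous (X : set 'rV[R]_M) :
  (forall x, X x -> forall m, x ord0 m \in `[a ord0 m, b ord0 m]) ->
  {within X, continuous (utility mean_utility tt)}.
Proof.
move=> XI; apply/subspace_continuousP => x Xx.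
(* K bounds the variation of the objective between x and any other feasible
   point; it is continuous everywhere and vanishes at x. *)
pose K (y : 'rV[R]_M) := \sum_(m < M) (\int[P]_w L m w) * `|x ord0 m - y ord0 m|.
have Kc : continuous K.
  apply: continuous_big => [|m _ z]; first exact: add_continuous.
  apply: (@continuous_comp _ _ _ (fun u : 'rV[R]_M => u ord0 m)
    (fun s : R => (\int[P]_w L m w) * `|x ord0 m - s|)).
    exact: coord_continuous.
  apply: cvgM; first exact: cvg_cst.
  by apply: cvg_norm; apply: cvgB; [exact: cvg_cst|exact: cvg_id].
have K0 : K x = 0 by rewrite /K big1// => m _; rewrite subrr normr0 mulr0.
apply/cvgrPdist_lt => e e0.
have /cvgr0Pnorm_lt /(_ e e0) : K y @[y --> x] --> 0.
  by rewrite -K0; exact: Kc.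
apply: filterS => y Ke Xy; apply: le_lt_trans Ke.
apply: le_trans (ler_norm _); rewrite -sumrB.
apply: le_trans (ler_norm_sum _ _ _) _; apply: ler_sum => m _.
by apply: mean_utility_lipschitz; exact: XI.
Qed.

End MeanUtility.

Lemma pwlin_utility_continuous (R : realType) (M : nat) (a b : 'rV[R]_M)
    (p : breakpoints a b) (v : 'I_M -> nat -> R) :
  continuous (pwlin_utility p v).
Proof.
apply: continuous_big => [|m _ z]; first exact: add_continuous.
apply: (@continuous_comp _ _ _ (fun u : 'rV[R]_M => u ord0 m)
  (pwlin (bnum p m) (bpt p m) (v m))); first exact: coord_continuous.
exact: pwlin_continuous.
Qed.
(** * Convergence of the piecewise linear approximation *)

Theorem proposition5 (R : realType) (d : measure_display)
  (T : measurableType d) (P : probability T R)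
  (M : nat) (a b : 'rV[R]_M)
  (U : 'I_M -> T -> R -> R)
  (U_meas : forall m s, s \in `[a ord0 m, b ord0 m] ->
     measurable_fun [set: T] (fun w => U m w s))
  (U_cont : forall m,
     {ae P, forall w, {within `[a ord0 m, b ord0 m], continuous (U m w)}})
  (U_mono : forall m,
     {ae P, forall w, {in `[a ord0 m, b ord0 m] &,
       {homo U m w : r s / r <= s}}})
  (U_a : forall m, {ae P, forall w, U m w (a ord0 m) = 0})
  (U_norm : {ae P, forall w, utility U w a = 0 /\ utility U w b = 1})
  (X : set 'rV[R]_M)
  (X_neq0 : X !=set0)
  (X_box : forall x, X x -> forall m, x ord0 m \in `[a ord0 m, b ord0 m])
  (X_compact : compact X)
  (L : 'I_M -> {RV P >-> R})
  (L_fin : forall m, ('E_P[L m] < +oo)%E)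
  (U_lip : forall m, {ae P, forall w,
     (L m w).-lipschitz_(`[a ord0 m, b ord0 m]%classic) (U m w)}) :
  let EU : 'rV[R]_M -> \bar R := fun x => ('E_P[fun w => utility U w x])%E in
  let Eu : breakpoints a b -> 'rV[R]_M -> \bar R := fun p x =>
    ('E_P[fun w => pwlin_utility p (increment p U w) x])%E in
  (forall p : breakpoints a b, exists theta thetaI : R,
     [/\ is_max [set EU x | x in X] theta%:E,
         is_max [set Eu p x | x in X] thetaI%:E &
         ((`|theta - thetaI|%R)%:E
            <= 'E_P[fun w => (\sum_(m < M) L m w)%R] * (bp_mesh p)%:E)%E])
  /\
  (forall p : nat -> breakpoints a b,
     (fun k => bp_total (p k)) @ \oo --> \oo ->
     (fun k => bp_mesh (p k)) @ \oo --> (0 : R) ->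
     (forall x : nat -> 'rV[R]_M,
        (forall k, argmax X (Eu (p k)) (x k)) ->
        cluster (x @ \oo) `<=` argmax X EU)
     /\
     (fun k => excess (argmax X (Eu (p k))) (argmax X EU)) @ \oo --> 0%E).
Proof.
move=> EU Eu.
pose F := utility (mean_utility P U) tt.
pose G (p : breakpoints a b) := pwlin_utility p (increment p (mean_utility P U) tt).
pose l : R := \sum_(m < M) \int[P]_w L m w.
(* Any system of breakpoints has at least one nondegenerate cell for each
   attribute, so its existence yields a m < b m. *)
have ab (p : breakpoints a b) m : a ord0 m < b ord0 m.
  rewrite -(bpt_first p m) -(bpt_last p m).
  apply: lt_le_trans (bpt_lt (bnum_gt0 p m)) _.
  by case/andP: (breakpoint_bounds (@bpt_lt _ _ _ _ p m) (bnum_gt0 p m)).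
have EUE (p : breakpoints a b) x : X x -> EU x = (F x)%:E.
  by move=> Xx; apply: (expectation_utility (ab p) U_meas U_a L_fin U_lip); exact: X_box.
have EuE : Eu = fun p x => (G p x)%:E.
  by apply/funext => p; apply/funext => x;
    exact: (expectation_pwlin_utility (ab p) U_meas U_a L_fin U_lip).
have argmaxE (p : breakpoints a b) : argmax X EU = argmax X (fun x => (F x)%:E).
  apply/seteqP; split=> x [Xx h]; split=> // y Xy; have := h y Xy;
  by rewrite !(EUE p).
have FG p z : X z -> `|F z - G p z| <= l * bp_mesh p.
  by move=> Xz; apply: (utility_pwlin_dist (ab p) U_meas U_a L_fin U_lip); exact: X_box.
have cF (p : breakpoints a b) : {within X, continuous F}.
  exact: (utility_mean_continuous (ab p) U_meas U_a L_fin U_lip).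
have cG p : {within X, continuous (G p)}.
  exact/continuous_subspaceT/pwlin_utility_continuous.
split=> [p|p _ mesh0].
  have [x xF] := argmax_neq0 X_neq0 X_compact (cF p).
  have [y yG] := argmax_neq0 X_neq0 X_compact (cG p).
  exists (F x), (G p y); split.
  - split; first by exists x; [case: xF|rewrite (EUE p)//; case: xF].
    by move=> _ [z Xz <-]; rewrite (EUE p)//; exact: xF.2.
  - rewrite EuE; split; first by exists y => //; case: yG.
    by move=> _ [z Xz <-]; exact: yG.2.
  - rewrite expectation_Rintegral; last first.
      apply: integrable_sum_EFin => m.
      exact: (lipschitz_modulus_integrable (ab p)).
    rewrite Rintegral_sum; last first.
      by move=> m; exact: (lipschitz_modulus_integrable (ab p)).
    by rewrite -EFinM lee_fin; exact: (max_value_dist (FG p)).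
have c0 : (fun k => l * bp_mesh (p k)) @ \oo --> (0 : R).
  by rewrite -(mulr0 l); apply: cvgM => //; exact: cvg_cst.
rewrite (argmaxE (p 0%N)) EuE.
split=> [x xopt|].
  apply: (cluster_argmax (G := fun k => G (p k)) _ _ _ c0) => //.
  - exact: compact_closed (@norm_hausdorff _ _) X_compact.
  - exact: cF (p 0%N).
  - by move=> k z; exact: FG.
apply: (excess_argmax_cvg0 (G := fun k => G (p k)) X_neq0 X_compact _ _ _ c0).
- exact: cF (p 0%N).
- by move=> k; exact: argmax_neq0.
- by move=> k z; exact: FG.
Qed.
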